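(* Let $k$ be an algebraically closed field with $\operatorname{char}(k)=p\neq 2,3$. Let $\mathcal{C}$ be a finite free EI category with three objects $x,y,z$ of one of the two types (first or second category) described in the context, and suppose that $k\mathcal{C}$ is of finite representation type. Then $H$ acts transitively on either $\mathcal{C}(x,y)$ or $\mathcal{C}(y,z)$ (for the second category: on either $\mathcal{C}(x,y)$ or $\mathcal{C}(z,y)$). Moreover, $|H_1\backslash H/H_2|=1$.
   Context: A finite EI category is a small category with finitely many morphisms in which every endomorphism is an isomorphism; all are assumed connected and skeletal. Composition is from right to left. The category algebra $k\mathcal{C}$ has basis the set of all morphisms, the product of two morphisms being their composite if it exists and $0$ otherwise; it is of finite representation type if it has only finitely many isomorphism classes of finitely generated indecomposable left modules. A morphism is unfactorizable if it is not an isomorphism and whenever it is a composite $\gamma\beta$, either $\beta$ or $\gamma$ is an isomorphism. A finite EI category is a finite free EI category if whenever a non-isomorphism has two decompositions $\alpha_m\cdots\alpha_1=\beta_n\cdots\beta_1$ into unfactorizable morphisms, then $m=n$, the intermediate objects $x_1,\ldots,x_{n-1}$ coincide, and there are $h_i\in\mathcal{C}(x_i,x_i)$ ($1\leqslant i\leqslant n-1$) with $h_1\alpha_1=\beta_1$, $h_i\alpha_i=\beta_i h_{i-1}$ for $2\leqslant i\leqslant n-1$, and $\alpha_n=\beta_n h_{n-1}$. Let $G=\mathcal{C}(x,x)$, $H=\mathcal{C}(y,y)$, $L=\mathcal{C}(z,z)$ (finite groups). First category: $\mathcal{C}(x,y)=H\alpha G$ is a single $(H,G)$-orbit, $\mathcal{C}(y,z)=L\beta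 H$ is a single $(L,H)$-orbit, $\mathcal{C}(x,z)=L\beta H\times_H H\alpha G$ (where $\times_H$ is the biset product, i.e. the Cartesian product modulo $(\gamma h,\delta)\sim(\gamma,h\delta)$ for $h\in H$, with composition the canonical map), and there are no other morphisms between distinct objects. Here $H_1=\operatorname{Stab}_H(\alpha G)=\{h\in H:h\alpha G=\alpha G\}$ and $H_2=\operatorname{Stab}_H(L\beta)=\{h\in H:L\beta h=L\beta\}$. Second category: $\mathcal{C}(x,y)=H\alpha G$ is a single $(H,G)$-orbit, $\mathcal{C}(z,y)=H\beta L$ is a single $(H,L)$-orbit, and there are no other morphisms between distinct objects. Here $H_1=\operatorname{Stab}_H(\alpha G)$ and $H_2=\operatorname{Stab}_H(\beta L)=\{h\in H:h\beta L=\beta L\}$. $H_1\backslash H/H_2$ is the set of double cosets. *)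

(* Defs.v *)
From HB Require Import structures.
From mathcomp Require Import all_boot all_order all_algebra all_fingroup.

Set Implicit Arguments.
Unset Strict Implicit.
Unset Printing Implicit Defensive.

Import GRing.Theory.
Local Open Scope ring_scope.

(* A category with finitely many morphisms has finitely many objects, since an
   object is determined by its identity. *)
Record finCat := FinCat {
  ob :> finType;
  mor : ob -> ob -> finType;
  idm : forall x, mor x x;
  compm : forall x y z, mor y z -> mor x y -> mor x z;
  compmA : forall w x y z (h : mor y z) (g : mor x y) (f : mor w x),
    compm h (compm g f) = compm (compm h g) f;
  comp1m : forall x y (f : mor x y), compm (idm y) f = f;
  compm1 : forall x y (f : mor x y), compm f (idm x) = f
}.

Arguments mor {C} x y : rename.
Arguments idm {C} x : rename.
Arguments compm {C x y z} g f : rename.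

Declare Scope cat_scope.
Delimit Scope cat_scope with cat.
Notation "g '\oc' f" := (compm g f) (at level 40, left associativity) : cat_scope.
Local Open Scope cat_scope.

Section CategoryNotions.
Variable C : finCat.

Definition is_iso (x y : C) (f : mor x y) : Prop :=
  exists g : mor y x, g \oc f = idm x /\ f \oc g = idm y.

Definition EI : Prop := forall (x : C) (f : mor x x), is_iso f.

Definition skeletal : Prop :=
  forall (x y : C) (f : mor x y), is_iso f -> x = y.

Definition connected_cat : Prop :=
  (0 < #|C|)%N /\
  forall x y : C,
    connect [rel u v : C | (0 < #|mor u v|)%N || (0 < #|mor v u|)%N] x y.

Definition unfactorizable (x z : C) (f : mor x z) : Prop :=
  ~ is_iso f /\
  forall (y : C) (c : mor y z) (b : mor x y),
    f = c \oc b -> is_iso b \/ is_iso c.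

(* [chain x y] is the type of nonempty sequences of composable morphisms
   alpha_n, ..., alpha_1 leading from x to y; [ChainS p a] is the chain that
   starts with a (i.e. has alpha_1 = a) and continues along p. *)
Inductive chain : C -> C -> Type :=
| Chain1 (x y : C) (a : mor x y) : chain x y
| ChainS (x y z : C) (p : chain y z) (a : mor x y) : chain x z.

Fixpoint composite (x y : C) (p : chain x y) : mor x y :=
  match p in chain x y return mor x y with
  | Chain1 _ _ a => a
  | ChainS _ _ _ p a => composite p \oc a
  end.

Fixpoint all_unfactorizable (x y : C) (p : chain x y) : Prop :=
  match p with
  | Chain1 _ _ a => unfactorizable a
  | ChainS _ _ _ p a => unfactorizable a /\ all_unfactorizable p
  end.

(* [ladder h0 p q hn] holds when p = (alpha_n, ..., alpha_1) and
   q = (beta_n, ..., beta_1) have the same length and the same intermediate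
   objects x_1, ..., x_(n-1), and there are h_i : x_i -> x_i such that
   h_i alpha_i = beta_i h_(i-1) for 1 <= i <= n, where h_0 = h0 and h_n = hn. *)
Inductive ladder :
  forall x y : C, mor x x -> chain x y -> chain x y -> mor y y -> Prop :=
| Ladder1 (x y : C) (h0 : mor x x) (h1 : mor y y) (a b : mor x y) :
    h1 \oc a = b \oc h0 -> ladder h0 (Chain1 a) (Chain1 b) h1
| LadderS (x y z : C) (h0 : mor x x) (h1 : mor y y) (hn : mor z z)
    (p q : chain y z) (a b : mor x y) :
    h1 \oc a = b \oc h0 -> ladder h1 p q hn ->
    ladder h0 (ChainS p a) (ChainS q b) hn.

(* The conditions h_1 alpha_1 = beta_1 and alpha_n = beta_n h_(n-1) are those
   of a ladder with h_0 and h_n identities. *)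
Definition free_cat : Prop :=
  forall (x y : C) (p q : chain x y),
    all_unfactorizable p -> all_unfactorizable q ->
    composite p = composite q -> ~ is_iso (composite p) ->
    ladder (idm x) p q (idm y).

End CategoryNotions.

Record finEICat := FinEICat {
  eicat :> finCat;
  eicat_EI : EI eicat;
  eicat_connected : connected_cat eicat;
  eicat_skeletal : skeletal eicat
}.

Section CategoryAlgebra.
Variables (k : pzRingType) (C : finCat).

Definition arrow := {u : C * C & mor u.1 u.2}.

Definition arr (x y : C) (f : mor x y) : arrow :=
  Tagged (fun u : C * C => mor u.1 u.2) (f : mor (x, y).1 (x, y).2).

Definition catalg := {ffun arrow -> k}.
HB.instance Definition _ := GRing.Zmodule.on catalg.
HB.instance Definition _ := GRing.Lmodule.copy catalg {ffun arrow -> k^o}.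

Implicit Types f g : catalg.

Definition basis_elt (m : arrow) : catalg := [ffun n => (n == m)%:R].

Definition catalg_one : catalg := \sum_(x : C) basis_elt (arr (idm x)).

(* The coefficient of f * g at a morphism m sums f_b g_a over the
   factorizations m = b a. *)
Definition catalg_mul f g : catalg :=
  [ffun m : arrow => \sum_(y : C) \sum_(b : mor y (tag m).2)
     \sum_(a : mor (tag m).1 y | b \oc a == tagged m) f (arr b) * g (arr a)].

Lemma catalg_mulE f g (x z : C) (c : mor x z) :
  catalg_mul f g (arr c) = \sum_(y : C) \sum_(b : mor y z)
     \sum_(a : mor x y | b \oc a == c) f (arr b) * g (arr a).
Proof. by rewrite ffunE. Qed.

Lemma arrE (m : arrow) : exists x y (f : mor x y), m = arr f.
Proof. by case: m => [[x y] f]; exists x, y, f. Qed.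

Lemma catalgP f g :
  (forall (x y : C) (c : mor x y), f (arr c) = g (arr c)) -> f = g.
Proof. by move=> e; apply/ffunP=> m; have [x [y [c ->]]] := arrE m. Qed.

Lemma arr_eq (x y : C) (f g : mor x y) : (arr f == arr g) = (f == g).
Proof. by rewrite /arr eq_Tagged. Qed.

Lemma arr_neq_tgt (x y x' y' : C) (f : mor x y) (g : mor x' y') :
  y != y' -> (arr f == arr g) = false.
Proof. by move=> ne; apply/negbTE; apply: contraNneq ne => -[_ ->]. Qed.

Lemma arr_neq_src (x y x' y' : C) (f : mor x y) (g : mor x' y') :
  x != x' -> (arr f == arr g) = false.
Proof. by move=> ne; apply/negbTE; apply: contraNneq ne => -[->]. Qed.

Lemma catalg_oneE (x y : C) (f : mor x y) :
  catalg_one (arr f) = (arr f == arr (idm x))%:R.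
Proof.
rewrite /catalg_one sum_ffunE (bigD1 x) //= ffunE big1 ?addr0 // => z zx.
by rewrite ffunE arr_neq_src // eq_sym.
Qed.

Lemma catalg_mul1 : left_id catalg_one catalg_mul.
Proof.
move=> f; apply: catalgP => x z c; rewrite catalg_mulE.
rewrite (bigD1 z) //= [X in _ + X]big1 ?addr0 => [|y yz]; last first.
  apply: big1 => b _; apply: big1 => a _.
  by rewrite catalg_oneE arr_neq_tgt ?mul0r // eq_sym.
rewrite (bigD1 (idm z)) //= [X in _ + X]big1 ?addr0 => [|b bz]; last first.
  by apply: big1 => a _; rewrite catalg_oneE arr_eq (negPf bz) mul0r.
rewrite (big_pred1 c) => [|a]; last by rewrite comp1m.
by rewrite catalg_oneE eqxx mul1r.
Qed.

Lemma catalg_mulr1 : right_id catalg_one catalg_mul.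
Proof.
move=> f; apply: catalgP => x z c; rewrite catalg_mulE.
rewrite (bigD1 x) //= [X in _ + X]big1 ?addr0 => [|y yx]; last first.
  apply: big1 => b _; apply: big1 => a _.
  by rewrite catalg_oneE arr_neq_tgt ?mulr0.
under eq_bigr => b _.
  rewrite big_mkcond (bigD1 (idm x)) //= [X in _ + X]big1 ?addr0; last first.
    by move=> a ax; rewrite catalg_oneE arr_eq (negPf ax) mulr0 if_same.
  rewrite catalg_oneE eqxx mulr1 compm1; over.
by rewrite -big_mkcond big_pred1_eq.
Qed.

Lemma catalg_mulDl : left_distributive catalg_mul +%R.
Proof.
move=> f g h; apply: catalgP => x z c; rewrite [RHS]ffunE !catalg_mulE.
rewrite -big_split; apply: eq_bigr => y _; rewrite -big_split.
apply: eq_bigr => b _; rewrite -big_split; apply: eq_bigr => a _.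
by rewrite ffunE mulrDl.
Qed.

Lemma catalg_mulDr : right_distributive catalg_mul +%R.
Proof.
move=> f g h; apply: catalgP => x z c; rewrite [RHS]ffunE !catalg_mulE.
rewrite -big_split; apply: eq_bigr => y _; rewrite -big_split.
apply: eq_bigr => b _; rewrite -big_split; apply: eq_bigr => a _.
by rewrite ffunE mulrDr.
Qed.

Lemma catalg_mulA : associative catalg_mul.
Proof.
move=> f g h; apply: catalgP => w z d.
transitivity (\sum_(x : C) \sum_(y : C) \sum_(a : mor w x) \sum_(b : mor x y)
  \sum_(c : mor y z | c \oc (b \oc a) == d) f (arr c) * (g (arr b) * h (arr a))).
  rewrite catalg_mulE exchange_big /=; apply: eq_bigr => y _.
  transitivity (\sum_(c : mor y z) \sum_(x : C) \sum_(a : mor w x)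
     \sum_(b : mor x y | c \oc (b \oc a) == d)
        f (arr c) * (g (arr b) * h (arr a))).
    apply: eq_bigr => c _.
    transitivity (\sum_(e : mor w y | c \oc e == d) \sum_(x : C)
      \sum_(a : mor w x) \sum_(b : mor x y | b \oc a == e)
        f (arr c) * (g (arr b) * h (arr a))).
      apply: eq_bigr => e _; rewrite catalg_mulE mulr_sumr.
      apply: eq_bigr => x _; rewrite mulr_sumr.
      under eq_bigr => b _ do rewrite mulr_sumr.
      by rewrite (exchange_big_dep xpredT).
    rewrite exchange_big /=; apply: eq_bigr => x _.
    rewrite exchange_big /=; apply: eq_bigr => a _.
    rewrite (exchange_big_dep (fun b : mor x y => c \oc (b \oc a) == d)) /=;
      last by move=> e b ec /eqP ->.
    apply: eq_bigr => b cba; rewrite (big_pred1 (b \oc a)) // => e /=.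
    by rewrite [RHS]eq_sym; case: (b \oc a =P e) => [<-|_]; rewrite ?cba ?andbF.
  rewrite exchange_big /=; apply: eq_bigr => x _.
  rewrite exchange_big /=; apply: eq_bigr => a _.
  by rewrite (exchange_big_dep xpredT).
rewrite [RHS]catalg_mulE; apply: eq_bigr => x _.
transitivity (\sum_(a : mor w x) \sum_(y : C) \sum_(c : mor y z)
   \sum_(b : mor x y | c \oc (b \oc a) == d)
      f (arr c) * (g (arr b) * h (arr a))).
  rewrite exchange_big /=; apply: eq_bigr => a _; apply: eq_bigr => y _.
  by rewrite (exchange_big_dep xpredT).
rewrite [RHS](exchange_big_dep xpredT) //=; apply: eq_bigr => a _.
transitivity (\sum_(e : mor x z | e \oc a == d) \sum_(y : C)
  \sum_(c : mor y z) \sum_(b : mor x y | c \oc b == e)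
     f (arr c) * (g (arr b) * h (arr a))); last first.
  apply: eq_bigr => e _; rewrite catalg_mulE mulr_suml.
  apply: eq_bigr => y _; rewrite mulr_suml.
  apply: eq_bigr => c _; rewrite mulr_suml.
  by apply: eq_bigr => b _; rewrite mulrA.
rewrite exchange_big /=; apply: eq_bigr => y _.
rewrite exchange_big /=; apply: eq_bigr => c _.
rewrite [RHS](exchange_big_dep (fun b : mor x y => c \oc (b \oc a) == d)) /=;
  last by move=> e b ec /eqP ce; rewrite compmA ce.
apply: eq_bigr => b cba; rewrite (big_pred1 (c \oc b)) // => e /=.
by rewrite [RHS]eq_sym; case: (c \oc b =P e) => [<-|_]; rewrite -?compmA ?cba ?andbF.
Qed.

HB.instance Definition _ := GRing.Zmodule_isPzRing.Build catalg
  catalg_mulA catalg_mul1 catalg_mulr1 catalg_mulDl catalg_mulDr.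

(* On basis elements the product is the composite if it exists, else 0. *)
Lemma basis_elt_mul (x y z : C) (b : mor y z) (a : mor x y) :
  basis_elt (arr b) * basis_elt (arr a) = basis_elt (arr (b \oc a)).
Proof.
apply: catalgP => x' z' c; rewrite catalg_mulE [RHS]ffunE.
have [e|ne] := eqVneq (x', z') (x, z); last first.
  rewrite [in RHS](_ : _ == _ = false); last first.
    by apply/negbTE; apply: contraNneq ne => -[-> ->].
  apply: big1 => y' _; apply: big1 => b' _; apply: big1 => a' _.
  rewrite !ffunE; have [ex|nx] := eqVneq x' x.
    rewrite (arr_neq_tgt b') ?mul0r //.
    by apply: contraNneq ne => ->; rewrite ex.
  by rewrite (arr_neq_src a') ?mulr0.
case: e => ex ez; case: _ / ex a => a; case: _ / ez b => b.
rewrite (bigD1 y) //= [X in _ + X]big1 ?addr0 => [|y' yy]; last first.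
  apply: big1 => b' _; apply: big1 => a' _.
  by rewrite !ffunE (arr_neq_src b') ?mul0r.
rewrite (bigD1 b) //= [X in _ + X]big1 ?addr0 => [|b' bb]; last first.
  by apply: big1 => a' _; rewrite !ffunE arr_eq (negPf bb) mul0r.
rewrite big_mkcond (bigD1 a) //= [X in _ + X]big1 ?addr0 => [|a' aa]; last first.
  by rewrite !ffunE !arr_eq (negPf aa) mulr0 if_same.
by rewrite !ffunE !arr_eq !eqxx mul1r eq_sym; case: eqP.
Qed.

Lemma basis_elt_mul0 (x y y' z : C) (b : mor y' z) (a : mor x y) :
  y' != y -> basis_elt (arr b) * basis_elt (arr a) = 0.
Proof.
move=> ne; apply: catalgP => x' z' c; rewrite catalg_mulE [RHS]ffunE.
apply: big1 => w _; apply: big1 => b' _; apply: big1 => a' _.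
rewrite !ffunE; have [ew|nw] := eqVneq w y.
  by rewrite (arr_neq_src b') ?mul0r // ew eq_sym.
by rewrite (arr_neq_tgt a') ?mulr0.
Qed.

End CategoryAlgebra.

Section RepresentationType.
Variable A : pzRingType.

Definition finitely_generated (M : lmodType A) : Prop :=
  exists (n : nat) (g : 'I_n -> M),
    forall v : M, exists c : 'I_n -> A, v = \sum_(i < n) c i *: g i.

Definition isomorphic (M N : lmodType A) : Prop :=
  exists f : {linear M -> N}, bijective f.

Definition indecomposable (M : lmodType A) : Prop :=
  (exists v : M, v != 0) /\
  forall U V : lmodType A, isomorphic M (U * V)%type ->
    (forall u : U, u = 0) \/ (forall v : V, v = 0).

Definition finite_representation_type : Prop :=
  exists (n : nat) (M : 'I_n -> lmodType A),
    forall N : lmodType A, finitely_generated N -> indecomposable N ->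
      exists i, isomorphic N (M i).

End RepresentationType.

Section Stabilizers.
Variable C : finEICat.

Definition autg (x : C) : Type := mor x x.
HB.instance Definition _ x := Finite.on (autg x).

Section AutGroup.
Variable x : C.

Lemma autg_inv_exists (f : autg x) : exists g : autg x, g \oc f == idm x.
Proof. by have [g [/eqP gf _]] := eicat_EI f; exists g. Qed.

Definition autg_inv (f : autg x) : autg x := xchoose (autg_inv_exists f).

Lemma autg_mulA : associative (fun g f : autg x => g \oc f : autg x).
Proof. by move=> h g f; apply: compmA. Qed.

Lemma autg_mul1 :
  left_id (idm x : autg x) (fun g f : autg x => g \oc f : autg x).
Proof. by move=> f; apply: comp1m. Qed.

Lemma autg_mulV :
  left_inverse (idm x : autg x) autg_inv (fun g f : autg x => g \oc f : autg x).
Proof. by move=> f; apply/eqP; apply: (xchooseP (autg_inv_exists f)). Qed.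

HB.instance Definition _ :=
  Finite_isGroup.Build (autg x) autg_mulA autg_mul1 autg_mulV.

End AutGroup.

Section Orbits.
Variables (x y : C).
Implicit Type a : mor x y.

Definition lorbit a : {set mor x y} := [set h \oc a | h : autg y].
Definition rorbit a : {set mor x y} := [set a \oc g | g : autg x].

Definition lstab a : {set autg y} :=
  [set h : autg y | [set h \oc f | f in rorbit a] == rorbit a].
Definition rstab a : {set autg x} :=
  [set h : autg x | [set f \oc h | f in lorbit a] == lorbit a].

Definition single_biorbit a : Prop :=
  forall f : mor x y, exists (h : autg y) (g : autg x), f = h \oc a \oc g.

Definition ltransitive : Prop :=
  forall f f' : mor x y, exists h : autg y, f' = h \oc f.
Definition rtransitive : Prop :=
  forall f f' : mor x y, exists h : autg x, f' = f \oc h.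

End Orbits.

(* Composition induces a bijection from the biset product
   C(y,z) x_H C(x,y) onto C(x,z), where H = C(y,y); as H is a group, the
   relation (c h, d) ~ (c, h d) is already an equivalence relation. *)
Definition comp_is_biset_product (x y z : C) : Prop :=
  (forall f : mor x z, exists (c : mor y z) (d : mor x y), f = c \oc d) /\
  (forall (c c' : mor y z) (d d' : mor x y),
     c \oc d = c' \oc d' <-> exists h : autg y, c = c' \oc h /\ d' = h \oc d).

Definition objects_are (x y z : C) : Prop :=
  uniq [:: x; y; z] /\ forall w : C, w \in [:: x; y; z].

Definition no_mors_outside (s : seq (C * C)) : Prop :=
  forall u v : C, u != v -> (u, v) \notin s -> mor u v -> False.

Definition first_type (x y z : C) (a : mor x y) (b : mor y z) : Prop :=
  [/\ single_biorbit a, single_biorbit b, comp_is_biset_product x y z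
    & no_mors_outside [:: (x, y); (y, z); (x, z)]].

Definition second_type (x y z : C) (a : mor x y) (b : mor z y) : Prop :=
  [/\ single_biorbit a, single_biorbit b
    & no_mors_outside [:: (x, y); (z, y)]].

End Stabilizers.

Definition double_cosets (gT : finGroupType) (A B : {set gT}) :
    {set {set gT}} :=
  [set (A * [set h] * B)%g | h : gT].

(* Main.v *)
From HB Require Import structures.
From mathcomp Require Import all_boot all_order all_algebra all_fingroup.
From mathcomp Require Import boolp.
Require Import Defs.

Set Implicit Arguments.
Unset Strict Implicit.
Unset Printing Implicit Defensive.

Import GRing.Theory.
Local Open Scope ring_scope.
Local Open Scope cat_scope.

(** If one of the conclusions fails, there is a family of modules M_b, indexed
    by b in the infinite field k, which are indecomposable and pairwise not
    isomorphic.

    All these modules are submodules of one kind of module. For a k-module U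
    the functions from the morphisms of C to U form a left module over the
    category algebra, with (a F)(m) = F(m a) or 0; for U = k it is the dual of
    the right regular module. M_b is the cyclic submodule generated by a single
    function D_b. A linear map from M_b to M_b' is determined by the image T of
    D_b, and T is killed by everything that kills D_b. If this forces
    T = s D_b' with s in k and s b = s b', then M_b has no endomorphisms but
    the scalars and M_b, M_b' are not isomorphic for b <> b'
    ([scalar_family_infinite_type]). So each case amounts to the choice of D_b
    and of a few linear relations between its translates.

    Double cosets. In the first category, for any group elements u and v, the
    morphisms beta u alpha and beta v alpha lie in the same orbit of L x G; this
    holds in C(x,z) for all objects x and z, since a function with value 1 on an
    orbit and b off it generates M_b when there are two orbits ([hom_biorbit]).
    In the second category the representation behind M_b is
    k -> k[H/H_1] <- k, where the first map picks the coset H_1 and the second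
    one an H_2-invariant vector; such vectors, up to scalars, form a family as
    soon as H_2 has two orbits on H/H_1 ([cospan_double_coset]).

    Transitivity. Let X be the set of H-orbits on C(x,y), and Y the analogous
    set for the other morphisms. If both have at least two elements, the trivial
    H-module k^2 receives a map from the permutation module kX that sends one
    basis vector to u_0 and all the others to u_1, and it is linked to kY
    likewise. When the orders of X and Y are prime to p, the two permutation
    modules contribute two lines each, and b comes from the cross-ratio of four
    points of the projective line; in general b comes from the trace of a
    product of two operators of rank 1. Permutation modules are never
    decomposed here, so that p may divide the orders of the groups
    ([serial_transitive], [cospan_transitive]). *)

(** * Cyclic submodules and infinite representation type *)

Section CyclicSubmodule.
Variables (A : pzRingType) (E : lmodType A) (D : E).

Definition cyclic_pred : {pred E} := fun v => `[< exists f : A, v = f *: D >].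

Lemma cyclic_submod_closed : submod_closed cyclic_pred.
Proof.
split=> [|c u v /asboolP [f ->] /asboolP [g ->]]; apply/asboolP.
  by exists 0; rewrite scale0r.
by exists (c * f + g); rewrite scalerDl scalerA.
Qed.

HB.instance Definition _ :=
  GRing.isSubmodClosed.Build A E cyclic_pred cyclic_submod_closed.

Definition cyclic_submod := {v : E | cyclic_pred v}.
HB.instance Definition _ := Choice.on cyclic_submod.
HB.instance Definition _ := SubType.on cyclic_submod.
HB.instance Definition _ := [SubChoice_isSubLmodule of cyclic_submod by <:].

Lemma cyclic_generatorP : cyclic_pred D.
Proof. by apply/asboolP; exists 1; rewrite scale1r. Qed.

Definition cyclic_generator : cyclic_submod := Sub D cyclic_generatorP.

Lemma cyclic_submodE (v : cyclic_submod) :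
  exists f : A, v = f *: cyclic_generator.
Proof.
have /asboolP [f ef] := valP v; exists f; apply: val_inj.
by rewrite linearZ /= -ef.
Qed.

Lemma cyclic_submod_fg : finitely_generated cyclic_submod.
Proof.
exists 1%N, (fun _ => cyclic_generator) => v.
by have [f ->] := cyclic_submodE v; exists (fun _ => f); rewrite big_ord1.
Qed.

End CyclicSubmodule.

(** [ann_le u v] says that u can be mapped to v by a linear map defined on the
    submodule generated by u. *)
Definition ann_le (A : pzRingType) (M N : lmodType A) (u : M) (v : N) : Prop :=
  forall f : A, f *: u = 0 -> f *: v = 0.

Lemma ann_le_preim (A : pzRingType) (M N P : lmodType A)
    (r : {linear M -> P}) (s : {linear N -> P}) (u : M) (v : N) :
  injective s -> r u = s v -> ann_le u v.
Proof.
move=> s_inj e f fu; apply: s_inj.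
by rewrite linearZ linear0 -e -linearZ fu linear0.
Qed.

Lemma cyclic_submod_ann_le (A : pzRingType) (E F : lmodType A) (D : E) (D' : F)
    (v : cyclic_submod D') :
  ann_le (cyclic_generator D) v -> ann_le D (val v).
Proof.
move=> le f fD; rewrite -linearZ le ?linear0 //.
by apply: val_inj; rewrite linearZ linear0.
Qed.

Section Criterion.
Variables (A : pzRingType) (E : lmodType A).

(** If M = U x V, the projection to U sends the generator D to c D for some
    scalar c; when c = 0 the component of D in U vanishes, and when c is
    invertible its component in V does. Both components are generators. *)
Lemma cyclic_submod_indecomposable (D : E) :
  D != 0 ->
  (forall T : E, T \in cyclic_pred D -> ann_le D T ->
     exists c : A, T = c *: D /\ (c = 0 \/ exists c', c' * c = 1)) ->
  indecomposable (cyclic_submod D).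
Proof.
move=> D0 brick; split.
  by exists (cyclic_generator D); apply: contra D0 => /eqP /(congr1 val) /= ->.
move=> U V [s [s' s'K sK]]; set g := cyclic_generator D.
have sg_gen (w : U * V) : exists f : A, w = f *: s g.
  by have [f ef] := cyclic_submodE (s' w); exists f; rewrite -linearZ -ef sK.
have annle : ann_le g (s' ((s g).1, 0)).
  move=> f fg; apply: (can_inj s'K); rewrite linearZ sK linear0.
  apply: injective_projections => /=; last by rewrite scaler0.
  by rewrite -[_ *: _]/((f *: s g).1) -linearZ fg linear0.
have [c [ec [c0|[c' cc]]]] := brick _ (valP (s' ((s g).1, 0)))
  (cyclic_submod_ann_le annle).
- left=> u; have u0 : (s g).1 = 0.
    have /(congr1 s) : s' ((s g).1, 0) = 0.
      by apply: val_inj; rewrite ec c0 scale0r linear0.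
    by rewrite sK linear0 => -[].
  by have [f /(congr1 fst) /= ->] := sg_gen (u, 0); rewrite u0 scaler0.
- right=> v; have v0 : (s g).2 = 0.
    have /(congr1 s) : s' ((s g).1, 0) = c *: g.
      by apply: val_inj; rewrite ec linearZ.
    rewrite sK linearZ => /(congr1 snd) /= e.
    by rewrite -[LHS]scale1r -cc -scalerA -e scaler0.
  by have [f /(congr1 snd) /= ->] := sg_gen (0, v); rewrite v0 scaler0.
Qed.

(** By the pigeonhole principle two members of a family of n + 1 modules are
    isomorphic to the same N i; the isomorphism between them has to be 0, which
    contradicts D i <> 0. *)
Lemma cyclic_family_infinite_type (I : choiceType) (D : I -> E) :
  (forall n, exists s : seq I, uniq s /\ size s = n) ->
  (forall i, D i != 0) ->
  (forall i j T, T \in cyclic_pred (D j) -> ann_le (D i) T ->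
     exists c : A, [/\ T = c *: D j, c = 0 \/ exists c', c' * c = 1
       & i != j -> c = 0]) ->
  ~ finite_representation_type A.
Proof.
move=> I_inf D0 brick [n [N N_all]].
have [s [s_uniq s_size]] := I_inf n.+1.
have ex_iso (a : seq_sub s) :
    exists i, isomorphic (cyclic_submod (D (val a))) (N i).
  apply: N_all; first exact: cyclic_submod_fg.
  apply: cyclic_submod_indecomposable => // T TD le.
  by have [c [? ? _]] := brick _ _ _ TD le; exists c.
have [h hP] := fin_all_exists ex_iso.
have /injectivePn [a [b ab eab]] : ~~ injectiveb h.
  apply/injectiveP => /leq_card.
  by rewrite card_ord card_seq_sub // s_size ltnn.
have [[ra [ra' raK ra'K]] [rb [rb' rbK rb'K]]] := (hP a, hP b).
move: ra rb ra' rb' raK ra'K rbK rb'K.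
rewrite eab => ra rb ra' rb' raK _ rbK rb'K.
pose v := rb' (ra (cyclic_generator _)).
have le : ann_le (cyclic_generator (D (val a))) v.
  apply: (ann_le_preim (r := ra) (s := rb)); first exact: can_inj rbK.
  by rewrite rb'K.
have [c [ec _ c0]] := brick _ _ _ (valP v) (cyclic_submod_ann_le le).
have v0 : v = 0.
  by apply: val_inj; rewrite ec c0 ?scale0r ?linear0.
have : cyclic_generator (D (val a)) = 0.
  by apply: (can_inj raK); rewrite linear0 -[LHS]rb'K -/v v0 linear0.
by move/(congr1 val) => /= /eqP; apply/negP.
Qed.

End Criterion.

Lemma closed_field_uniq_seq (k : closedFieldType) (n : nat) :
  exists s : seq k, uniq s /\ size s = n.
Proof.
elim: n => [|n [s [s_uniq s_size]]]; first by exists [::].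
have [|a] := closed_nonrootP (\prod_(b <- s) ('X - b%:P)) _.
  by rewrite monic_neq0 // monic_prod_XsubC.
by rewrite root_prod_XsubC => a_s; exists (a :: s); rewrite /= a_s s_uniq
  s_size.
Qed.

(** * Functions on the morphisms of a category *)

Section CategoryFunctions.
Variables (k : pzRingType) (C : finCat) (U : lmodType k).

(** An alias of its own, because {ffun arrow C -> U} is already a module over
    k. *)
Definition catfun := {ffun arrow C -> U}.
HB.instance Definition _ := GRing.Zmodule.on catfun.

Definition catfun_act (f : catalg k C) (F : catfun) : catfun :=
  [ffun m : arrow C => \sum_(w : C) \sum_(a : mor w (tag m).1)
     f (arr a) *: F (arr (tagged m \oc a))].

Lemma catfun_actE f F (u v : C) (m : mor u v) :
  catfun_act f F (arr m) =
  \sum_(w : C) \sum_(a : mor w u) f (arr a) *: F (arr (m \oc a)).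
Proof. by rewrite ffunE. Qed.

Lemma catfunP (F G : catfun) :
  (forall (u v : C) (m : mor u v), F (arr m) = G (arr m)) -> F = G.
Proof. by move=> e; apply/ffunP=> m; have [u [v [c ->]]] := arrE m. Qed.

Lemma catfun_act_basis (w u v : C) (a : mor w u) (m : mor u v) F :
  catfun_act (basis_elt k (arr a)) F (arr m) = F (arr (m \oc a)).
Proof.
rewrite catfun_actE (bigD1 w) //= [X in _ + X]big1 ?addr0 => [|w' ww]; last first.
  by apply: big1 => b _; rewrite ffunE arr_neq_src ?scale0r.
rewrite (bigD1 a) //= [X in _ + X]big1 ?addr0 => [|b ba]; last first.
  by rewrite ffunE arr_eq (negPf ba) scale0r.
by rewrite ffunE eqxx scale1r.
Qed.

Lemma catfun_act_basis_neq (w u u' v : C) (a : mor w u') (m : mor u v) F :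
  u != u' -> catfun_act (basis_elt k (arr a)) F (arr m) = 0.
Proof.
move=> uu; rewrite catfun_actE big1 // => w' _; apply: big1 => b _.
by rewrite ffunE arr_neq_tgt ?scale0r.
Qed.

(** Both sides sum f_b g_a F(m b a) over all factorizations. *)
Lemma catfun_actA f g F :
  catfun_act f (catfun_act g F) = catfun_act (f * g) F.
Proof.
apply: catfunP => u v m; rewrite !catfun_actE.
transitivity (\sum_(w : C) \sum_(y : C) \sum_(b : mor y u) \sum_(a : mor w y)
   (f (arr b) * g (arr a)) *: F (arr (m \oc (b \oc a)))).
  rewrite exchange_big; apply: eq_bigr => y _ /=.
  rewrite exchange_big; apply: eq_bigr => b _ /=.
  rewrite catfun_actE scaler_sumr; apply: eq_bigr => w _ /=.
  by rewrite scaler_sumr; apply: eq_bigr => a _; rewrite scalerA compmA.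
apply: eq_bigr => w _.
transitivity (\sum_(c : mor w u) \sum_(y : C) \sum_(b : mor y u)
   \sum_(a : mor w y | b \oc a == c)
   (f (arr b) * g (arr a)) *: F (arr (m \oc c))); last first.
  apply: eq_bigr => c _; rewrite catalg_mulE scaler_suml.
  apply: eq_bigr => y _; rewrite scaler_suml.
  by apply: eq_bigr => b _; rewrite scaler_suml.
rewrite exchange_big; apply: eq_bigr => y _ /=.
rewrite [RHS]exchange_big; apply: eq_bigr => b _ /=.
rewrite [RHS](exchange_big_dep xpredT) //=; apply: eq_bigr => a _.
by rewrite (big_pred1 (b \oc a)) // => c; rewrite /= eq_sym.
Qed.

Lemma catfun_act1 : left_id 1 catfun_act.
Proof.
have oneE (u v : C) (a : mor u v) :
  (1 : catalg k C) (arr a) = (arr a == arr (idm u))%:R := catalg_oneE k a.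
move=> F; apply: catfunP => u v m; rewrite catfun_actE.
rewrite (bigD1 u) //= [X in _ + X]big1 ?addr0 => [|w wu]; last first.
  apply: big1 => a _.
  by rewrite oneE arr_neq_tgt ?scale0r // eq_sym.
rewrite (bigD1 (idm u)) //= [X in _ + X]big1 ?addr0 => [|a au]; last first.
  by rewrite oneE arr_eq (negPf au) scale0r.
by rewrite oneE eqxx scale1r compm1.
Qed.

Lemma catfun_actDr : right_distributive catfun_act +%R.
Proof.
move=> f F G; apply: catfunP => u v m; rewrite [RHS]ffunE !catfun_actE -big_split.
apply: eq_bigr => w _; rewrite -big_split; apply: eq_bigr => a _ /=.
by rewrite ffunE scalerDr.
Qed.

Lemma catfun_actDl F : {morph catfun_act^~ F : f g / f + g}.
Proof.
move=> f g; apply: catfunP => u v m; rewrite [RHS]ffunE !catfun_actE -big_split.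
apply: eq_bigr => w _; rewrite -big_split; apply: eq_bigr => a _ /=.
by rewrite ffunE scalerDl.
Qed.

HB.instance Definition _ := GRing.Zmodule_isLmodule.Build (catalg k C) catfun
  catfun_actA catfun_act1 catfun_actDr catfun_actDl.

End CategoryFunctions.

Section CategoryFunctionsOverField.
Variables (k : fieldType) (C : finCat) (U : lmodType k).
Implicit Types (D T : catfun C U).

Definition extend (x y : C) (phi : mor x y -> U) : catfun C U :=
  [ffun n => \sum_(m | arr m == n) phi m].

Lemma extendE (x y : C) (phi : mor x y -> U) (m : mor x y) :
  extend phi (arr m) = phi m.
Proof.
by rewrite ffunE (big_pred1 m) // => a; rewrite /= arr_eq.
Qed.

Lemma extend_src (x y u v : C) (phi : mor x y -> U) (m : mor u v) :
  u != x -> extend phi (arr m) = 0.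
Proof.
by move=> ux; rewrite ffunE big_pred0 // => a; rewrite arr_neq_src // eq_sym.
Qed.

Lemma extend_tgt (x y u v : C) (phi : mor x y -> U) (m : mor u v) :
  v != y -> extend phi (arr m) = 0.
Proof.
by move=> ux; rewrite ffunE big_pred0 // => a; rewrite arr_neq_tgt // eq_sym.
Qed.

Lemma catfun_scalarE (s : k) D (n : arrow C) :
  ((s *: (1 : catalg k C)) *: D) n = s *: D n.
Proof.
have [u [v [m ->]]] := arrE n.
have <- : ((1 : catalg k C) *: D) (arr m) = D (arr m) by rewrite scale1r.
rewrite !catfun_actE [RHS]scaler_sumr.
apply: eq_bigr => w _; rewrite [RHS]scaler_sumr; apply: eq_bigr => a _.
by rewrite ffunE scalerA.
Qed.

Lemma catfun_subE D T (n : arrow C) : (D - T) n = D n - T n.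
Proof. by rewrite !ffunE. Qed.

Definition hom_comb (I : finType) (x y : C) (a : I -> mor x y) (r : I -> k) :
    catalg k C :=
  \sum_i r i *: basis_elt k (arr (a i)).

(** Scalars act through elements of the category algebra; hence linear maps over
    that algebra respect the multiplication by scalars. *)
Lemma scalar_mulE (s : k) (f : catalg k C) :
  s *: f = (s *: (1 : catalg k C)) * f.
Proof.
apply: catalgP => x z c; rewrite catalg_mulE -[in LHS](mul1r f) [LHS]ffunE.
rewrite catalg_mulE [LHS]scaler_sumr; apply: eq_bigr => y _.
rewrite [LHS]scaler_sumr; apply: eq_bigr => b _; rewrite [LHS]scaler_sumr.
by apply: eq_bigr => a _; rewrite ffunE [LHS]mulrA.
Qed.

Lemma hom_combE (I : finType) (x y : C) (a : I -> mor x y) (r : I -> k) D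
    (v : C) (m : mor y v) :
  (hom_comb a r *: D) (arr m) = \sum_i r i *: D (arr (m \oc a i)).
Proof.
rewrite scaler_suml sum_ffunE; apply: eq_bigr => i _.
by rewrite scalar_mulE -scalerA catfun_scalarE [X in _ *: X]catfun_act_basis.
Qed.

Lemma hom_comb_neq (I : finType) (x y : C) (a : I -> mor x y) (r : I -> k) D
    (u v : C) (m : mor u v) :
  u != y -> (hom_comb a r *: D) (arr m) = 0.
Proof.
move=> uy; rewrite scaler_suml sum_ffunE big1 // => i _.
rewrite scalar_mulE -scalerA catfun_scalarE.
by rewrite [X in _ *: X]catfun_act_basis_neq // scaler0.
Qed.

(** A linear relation between the translates of D by morphisms with common
    target y, being a relation of elements of the module, is shared by the
    translates of T; evaluating the latter at the identity of y yields a
    relation between values of T. *)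
Lemma ann_le_rel (I J : finType) (x z y : C) (a : I -> mor x y) (r : I -> k)
    (b : J -> mor z y) (s : J -> k) D T :
  ann_le D T ->
  (forall (v : C) (m : mor y v),
     \sum_i r i *: D (arr (m \oc a i)) = \sum_j s j *: D (arr (m \oc b j))) ->
  \sum_i r i *: T (arr (a i)) = \sum_j s j *: T (arr (b j)).
Proof.
move=> le rel; have /le : (hom_comb a r - hom_comb b s) *: D = 0.
  apply: catfunP => u v m; rewrite scalerBl catfun_subE [RHS]ffunE.
  have [e|uy] := eqVneq u y; last by rewrite !hom_comb_neq ?subr0.
  by subst u; rewrite !hom_combE rel subrr.
move=> /(congr1 (fun F : catfun C U => F (arr (idm y)))) /eqP.
rewrite scalerBl catfun_subE [X in _ == X]ffunE !hom_combE subr_eq0.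
under eq_bigr do rewrite comp1m.
by under [X in _ == X]eq_bigr do rewrite comp1m; move/eqP.
Qed.

(** D is killed by the identity of u, hence so is T. *)
Lemma ann_le_src (u v : C) (a : mor u v) D T :
  ann_le D T -> (forall (v' : C) (m : mor u v'), D (arr m) = 0) ->
  T (arr a) = 0.
Proof.
move=> le D0; have := ann_le_rel (a := fun _ : 'I_1 => a) (r := fun=> 1)
  (b := fun _ : 'I_0 => idm v) (s := fun=> 0) le.
rewrite big_ord1 big_ord0 scale1r; apply=> v' m.
by rewrite big_ord1 big_ord0 D0 scaler0.
Qed.

Lemma cyclic_pred_at (x y : C) D T :
  T \in cyclic_pred D ->
  (forall (w : C) (m : mor x y) (a : mor w x), w != x -> D (arr (m \oc a)) = 0) ->
  exists t : mor x x -> k,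
    forall m : mor x y, T (arr m) = \sum_g t g *: D (arr (m \oc g)).
Proof.
move=> /asboolP [f ->] D0; exists (fun g => f (arr g)) => m.
rewrite catfun_actE (bigD1 x) //= [X in _ + X]big1 ?addr0 // => w wx.
by apply: big1 => a _; rewrite D0 ?scaler0.
Qed.

Lemma cyclic_pred_tgt (u v : C) (m : mor u v) D T :
  T \in cyclic_pred D -> (forall (u' : C) (m' : mor u' v), D (arr m') = 0) ->
  T (arr m) = 0.
Proof.
move=> /asboolP [f ->] D0; rewrite catfun_actE big1 // => w _.
by rewrite big1 // => a _; rewrite D0 scaler0.
Qed.

End CategoryFunctionsOverField.

Lemma scalar_family_infinite_type (k : closedFieldType) (C : finCat)
    (U : lmodType k) (D : k -> catfun C U) :
  (forall b, D b != 0) ->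
  (forall b b' T, T \in cyclic_pred (D b') -> ann_le (D b) T ->
     exists s : k, (forall (u v : C) (m : mor u v),
        T (arr m) = s *: D b' (arr m)) /\ s * b = s * b') ->
  ~ finite_representation_type (catalg k C).
Proof.
move=> D0 brick; apply: (cyclic_family_infinite_type (D := D)) => //.
  exact: closed_field_uniq_seq.
move=> b b' T TD le; have [s [eT sb]] := brick _ _ _ TD le.
exists (s *: (1 : catalg k C)); split.
- by apply: catfunP => u v m; rewrite eT catfun_scalarE.
- have [->|s0] := eqVneq s 0; first by left; rewrite scale0r.
  right; exists (s^-1 *: (1 : catalg k C)).
  by rewrite -scalar_mulE scalerA mulVf ?scale1r.
- move=> bb'; have [->|s0] := eqVneq s 0; first by rewrite scale0r.
  by move: bb'; rewrite (mulfI s0 sb) eqxx.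
Qed.

(** * Orbits of morphisms *)

(** The indicator of a set of representatives serves as weight. Such weights
    allow one to sum over classes by summing over their elements, also where
    dividing by the size of a class is impossible in k. *)
Lemma orbit_weight (k : closedFieldType) (X : finType) (R : rel X) :
  equivalence_rel R ->
  exists w : X -> k, forall t, \sum_(s | R t s) w s = 1.
Proof.
move=> Req; have RR t : R t t by rewrite (Req t t t).1.
pose rep t := choose (R t) t.
have repP t : R t (rep t) by apply: chooseP.
have rep_eq t s : R t s -> rep s = rep t.
  move=> ts; rewrite /rep -(eq_choose (P := R t)).
    exact: choose_id.
  by move=> u; apply: (Req t s u).2.
exists (fun s => (s == rep s)%:R) => t.
rewrite (bigD1 (rep t)) //= (rep_eq t) // eqxx big1 ?addr0 // => s /andP[ts st].
by rewrite (rep_eq _ _ ts) (negPf st).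
Qed.

Section Orbits.
Variables (C : finEICat).

Lemma autVm (x y : C) (h : autg y) (f : mor x y) : (h^-1)%g \oc (h \oc f) = f.
Proof. by rewrite compmA -[_ \oc h]/((h^-1 * h)%g) mulVg; apply: comp1m. Qed.

Lemma autmV (x y : C) (h : autg y) (f : mor x y) : h \oc ((h^-1)%g \oc f) = f.
Proof. by rewrite compmA -[h \oc _]/((h * h^-1)%g) mulgV; apply: comp1m. Qed.

Lemma mautV (x y : C) (f : mor x y) (g : autg x) : f \oc g \oc (g^-1)%g = f.
Proof. by rewrite -compmA -[g \oc _]/((g * g^-1)%g) mulgV; apply: compm1. Qed.

Lemma mVaut (x y : C) (f : mor x y) (g : autg x) : f \oc (g^-1)%g \oc g = f.
Proof. by rewrite -compmA -[_ \oc g]/((g^-1 * g)%g) mulVg; apply: compm1. Qed.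

Lemma lorbitP (x y : C) (f f' : mor x y) :
  reflect (exists h : autg y, f' = h \oc f) (f' \in lorbit f).
Proof. by apply: (iffP imsetP) => [[h _ ->]|[h ->]]; exists h. Qed.

Lemma rorbitP (x y : C) (f f' : mor x y) :
  reflect (exists g : autg x, f' = f \oc g) (f' \in rorbit f).
Proof. by apply: (iffP imsetP) => [[h _ ->]|[h ->]]; exists h. Qed.

Lemma lorbit_comp (x y : C) (f f' : mor x y) (h : autg y) :
  (h \oc f' \in lorbit f) = (f' \in lorbit f).
Proof.
apply/lorbitP/lorbitP=> -[h' e]; last by exists (h * h')%g; rewrite e compmA.
by exists (h^-1 * h')%g; rewrite -[f'](autVm h) e compmA.
Qed.

Lemma rorbit_comp (x y : C) (f f' : mor x y) (g : autg x) :
  (f' \oc g \in rorbit f) = (f' \in rorbit f).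
Proof.
apply/rorbitP/rorbitP=> -[h' e]; last by exists (h' * g)%g; rewrite e -compmA.
by exists (h' * g^-1)%g; rewrite -[f'](mautV _ g) e -compmA.
Qed.

Lemma lorbit_id (x y : C) (f : mor x y) : f \in lorbit f.
Proof. by apply/lorbitP; exists (idm y); rewrite comp1m. Qed.

Lemma rorbit_id (x y : C) (f : mor x y) : f \in rorbit f.
Proof. by apply/rorbitP; exists (idm x); rewrite compm1. Qed.

Lemma lorbit_sym (x y : C) (f f' : mor x y) :
  (f' \in lorbit f) = (f \in lorbit f').
Proof.
by apply/lorbitP/lorbitP=> -[h ->]; exists (h^-1)%g; rewrite autVm.
Qed.

Lemma rorbit_sym (x y : C) (f f' : mor x y) :
  (f' \in rorbit f) = (f \in rorbit f').
Proof.
by apply/rorbitP/rorbitP=> -[h ->]; exists (h^-1)%g; rewrite mautV.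
Qed.

Lemma lorbit_equivalence (x y : C) :
  equivalence_rel (fun f f' : mor x y => f' \in lorbit f).
Proof.
move=> f f' f''; split; first exact: lorbit_id.
move=> /lorbitP [h ->].
by rewrite lorbit_sym [RHS]lorbit_sym lorbit_comp.
Qed.

Lemma rorbit_equivalence (x y : C) :
  equivalence_rel (fun f f' : mor x y => f' \in rorbit f).
Proof.
move=> f f' f''; split; first exact: rorbit_id.
move=> /rorbitP [h ->].
by rewrite rorbit_sym [RHS]rorbit_sym rorbit_comp.
Qed.

Lemma ltransitiveVorbits (x y : C) :
  ltransitive x y \/ exists f f' : mor x y, f' \notin lorbit f.
Proof.
have [|ntr] := pselect (exists f f' : mor x y, f' \notin lorbit f).
  by right.
left=> f f'; apply/lorbitP; apply: contrapT => /negP f'f.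
by apply: ntr; exists f, f'.
Qed.

Lemma rtransitiveVorbits (x y : C) :
  rtransitive x y \/ exists f f' : mor x y, f' \notin rorbit f.
Proof.
have [|ntr] := pselect (exists f f' : mor x y, f' \notin rorbit f).
  by right.
left=> f f'; apply/rorbitP; apply: contrapT => /negP f'f.
by apply: ntr; exists f, f'.
Qed.

Lemma lstab_mem (x y : C) (f : mor x y) (h : autg y) :
  h \oc f \in rorbit f -> h \in lstab f.
Proof.
move=> /rorbitP [g eg]; rewrite inE; apply/eqP/setP=> f'.
apply/imsetP/rorbitP => [[_ /rorbitP [g' ->] ->]|[g' ->]].
  by exists (g * g')%g; rewrite compmA eg compmA.
exists (f \oc (g^-1 * g')%g); first by apply/rorbitP; exists (g^-1 * g')%g.
by rewrite [RHS]compmA eg -compmA -[g \oc _]/(g * (g^-1 * g'))%g mulKVg.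
Qed.

Lemma rstab_mem (x y : C) (f : mor x y) (g : autg x) :
  f \oc g \in lorbit f -> g \in rstab f.
Proof.
move=> /lorbitP [h eh]; rewrite inE; apply/eqP/setP=> f'.
apply/imsetP/lorbitP => [[_ /lorbitP [h' ->] ->]|[h' ->]].
  by exists (h' * h)%g; rewrite -compmA eh compmA.
exists ((h' * h^-1)%g \oc f); first by apply/lorbitP; exists (h' * h^-1)%g.
by rewrite -[RHS]compmA eh compmA -[_ \oc h]/(h' * h^-1 * h)%g mulgKV.
Qed.

End Orbits.

(** Group the sum by the classes of f g^-1 modulo the left action: the class of
    d contributes the sum of t g over all g with d g in the class of f. *)
Lemma sum_translates (k : closedFieldType) (C : finEICat) (x y : C)
    (f : mor x y) (t : mor x x -> k) :
  (forall d : mor x y, d \notin lorbit f ->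
     \sum_(g | d \oc g \in lorbit f) t g = 0) ->
  \sum_g t g = \sum_(g | f \oc g \in lorbit f) t g.
Proof.
move=> t0; have [w w1] := orbit_weight k (lorbit_equivalence (x := x) (y := y)).
have trans (g : autg x) (d : mor x y) :
    (d \oc g \in lorbit f) = (d \in lorbit (f \oc (g^-1)%g)).
  apply/lorbitP/lorbitP=> -[h e]; exists h; first by rewrite compmA -e mautV.
  by rewrite e -compmA mVaut.
transitivity (\sum_(d : mor x y) w d * \sum_(g | d \oc g \in lorbit f) t g).
  under [RHS]eq_bigr do rewrite mulr_sumr.
  rewrite (exchange_big_dep xpredT) //=; apply: eq_bigr => g _.
  by rewrite -mulr_suml (eq_bigl _ _ (trans g)) w1 mul1r.
rewrite (bigID (mem (lorbit f))) /=.
rewrite [X in _ + X]big1 ?addr0 => [|d df]; last by rewrite t0 ?mulr0.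
transitivity (\sum_(d in lorbit f) w d * \sum_(g | f \oc g \in lorbit f) t g).
  apply: eq_bigr => _ /lorbitP [h ->]; congr (_ * _); apply: eq_bigl => g.
  by rewrite -compmA lorbit_comp.
by rewrite -mulr_suml w1 mul1r.
Qed.

(** * One hom-set: double cosets and transitivity in the first category *)

Section FiniteType.
Variables (k : closedFieldType) (C : finEICat).
Hypothesis C_finite : finite_representation_type (catalg k C).

(** Reduction of [scalar_family_infinite_type] to functions on one hom-set.
    The elements of the submodule generated by [phi b'] are combinations of
    translates by endomorphisms of x, and relations between translates of
    [phi b] need to be tested against endomorphisms of z only. *)
Lemma hom_family_absurd (U : lmodType k) (x z : C) (phi : k -> mor x z -> U) :
  (forall b, exists m, phi b m != 0) ->
  (forall b b' (T : mor x z -> U),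
     (exists t : mor x x -> k, forall m, T m = \sum_g t g *: phi b' (m \oc g)) ->
     (forall (I : finType) (a : I -> mor x z) (r : I -> k) (c : mor x z) (s : k),
        (forall l : autg z,
           \sum_i r i *: phi b (l \oc a i) = s *: phi b (l \oc c)) ->
        \sum_i r i *: T (a i) = s *: T c) ->
     exists s : k, (forall m, T m = s *: phi b' m) /\ s * b = s * b') ->
  False.
Proof.
move=> phi0 brick.
case: (@scalar_family_infinite_type k C U (fun b => extend (phi b))) => //.
  move=> b; have [m m0] := phi0 b; apply: contra_neq m0.
  by move/(congr1 (fun F : catfun C U => F (arr m))); rewrite extendE ffunE.
move=> b b' T TD le.
have [||s [Ts sb]] := brick b b' (fun m => T (arr m)).
- have [|t Tt] := cyclic_pred_at (x := x) (y := z) TD.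
    by move=> w m a wx; rewrite extend_src.
  by exists t => m; rewrite Tt; apply: eq_bigr => g _; rewrite extendE.
- move=> I a r c s rel.
  have := ann_le_rel (a := a) (r := r) (b := fun _ : 'I_1 => c) (s := fun=> s) le.
  rewrite big_ord1; apply=> v m; rewrite big_ord1.
  have [ev|vz] := eqVneq v z.
    by subst v; rewrite extendE -rel; apply: eq_bigr => i _; rewrite extendE.
  by rewrite big1 => [|i _]; rewrite extend_tgt ?scaler0.
exists s; split=> // u v m; have [ev|vz] := eqVneq v z; last first.
  rewrite (cyclic_pred_tgt m TD) ?extend_tgt ?scaler0 // => u' m'.
  by rewrite extend_tgt.
subst v; have [eu|ux] := eqVneq u x; first by subst u; rewrite extendE Ts.
rewrite (ann_le_src m le) ?extend_src ?scaler0 // => v' m'.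
by rewrite extend_src.
Qed.

(** With B the orbit of e0, the function D_b is 1 on B and b off B. Its
    translates by the groups at x and z are D_b again, and a morphism e off B
    acts on it as b times e0. *)
Lemma hom_biorbit (x z : C) (e0 e1 : mor x z) :
  exists (l : autg z) (g : autg x), e1 = l \oc e0 \oc g.
Proof.
pose B (m : mor x z) :=
  [exists l : autg z, exists g : autg x, m == l \oc e0 \oc g].
have Bg m (g : autg x) : B (m \oc g) = B m.
  apply/existsP/existsP=> -[l /existsP [h /eqP e]]; exists l; apply/existsP.
    by exists (h * g^-1)%g; rewrite -[m](mautV _ g) e -!compmA.
  by exists (h * g)%g; rewrite e -!compmA.
have Bl m (l : autg z) : B (l \oc m) = B m.
  apply/existsP/existsP=> -[h /existsP [g /eqP e]].
    exists (l^-1 * h)%g; apply/existsP; exists g.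
    by rewrite -[m](autVm l) e !compmA.
  by exists (l * h)%g; apply/existsP; exists g; rewrite e !compmA.
have B0 : B e0.
  apply/existsP; exists (idm z); apply/existsP; exists (idm x).
  by rewrite compm1 comp1m.
have [/existsP [l /existsP [g /eqP e]]|B1] := boolP (B e1).
  by exists l, g.
pose phi (b : k) (m : mor x z) : k^o := if B m then 1 else b.
exfalso; apply: (hom_family_absurd (phi := phi)).
  by move=> b; exists e0; rewrite /phi B0 oner_eq0.
move=> b b' T [t Tt] rel; pose s := \sum_g t g.
have Ts m : T m = s *: phi b' m.
  by rewrite Tt scaler_suml; apply: eq_bigr => g _; rewrite /phi Bg.
exists s; split=> //.
have : T e1 = b *: T e0.
  have := rel ('I_1 : finType) (fun=> e1) (fun=> 1) e0 b.
  rewrite big_ord1 scale1r; apply=> l.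
  by rewrite big_ord1 scale1r /phi !Bl B0 (negPf B1) [_ *: _]mulr1.
rewrite !Ts /phi B0 (negPf B1) => e.
by have -> : s * b' = b * (s * 1) := e; rewrite mulr1 mulrC.
Qed.

(** Here D_b is b plus the indicator of c0 H d0. As C(x,z) is the biset product,
    D_b(c d) depends on the classes of c and d modulo H only: it is b + 1 on
    the pair of classes of c0 and d0, and b on all other pairs. *)
Lemma serial_transitive (x y z : C) :
  comp_is_biset_product x y z -> ltransitive x y \/ rtransitive y z.
Proof.
move=> [bis_surj bisP].
have [|[d0 [d1 d1d0]]] := ltransitiveVorbits x y; first by left.
have [|[c0 [c1 c1c0]]] := rtransitiveVorbits y z; first by right.
exfalso.
pose B (m : mor x z) := [exists h : autg y, m == c0 \oc h \oc d0].
have BE c d : B (c \oc d) = (c \in rorbit c0) && (d \in lorbit d0).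
  apply/existsP/andP=> [[h /eqP/bisP [h' [-> e]]]|]; last first.
    move=> [/rorbitP [h ->] /lorbitP [h' ->]].
    by exists (h * h')%g; rewrite -!compmA.
  rewrite rorbit_comp lorbit_sym e lorbit_comp lorbit_id.
  by split=> //; apply/rorbitP; exists h.
pose phi (b : k) (m : mor x z) : k^o := b + (B m)%:R.
apply: (hom_family_absurd (phi := phi)) => [b|b b' T [t Tt] rel].
  have [b0|b_neq0] := eqVneq b 0; last first.
    by exists (c0 \oc d1); rewrite /phi BE (negPf d1d0) andbF addr0.
  exists (c0 \oc d0).
  by rewrite /phi BE rorbit_id lorbit_id b0 add0r oner_eq0.
pose s := \sum_g t g; pose td d := \sum_(g | d \oc g \in lorbit d0) t g.
have Tcd c d : T (c \oc d) = s * b' + (c \in rorbit c0)%:R * td d.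
  rewrite Tt /s /td mulr_suml mulr_sumr [X in _ + X]big_mkcond -big_split /=.
  apply: eq_bigr => g _; rewrite /phi -compmA BE [_ *: _]mulrDr.
  by case: (c \in _); case: ifP => _; rewrite /= ?mulr1 ?mul1r ?mulr0 ?mul0r.
(* c0 and c1 act in the same way on d D_b if d is not in the orbit of d0. *)
have td0 d : d \notin lorbit d0 -> td d = 0.
  move=> dd; have : T (c0 \oc d) = T (c1 \oc d).
    have := rel ('I_1 : finType) (fun=> c0 \oc d) (fun=> 1) (c1 \oc d) 1.
    rewrite big_ord1 !scale1r; apply=> l.
    by rewrite big_ord1 !scale1r /phi !compmA !BE (negPf dd) !andbF.
  rewrite !Tcd rorbit_id (negPf c1c0) mul1r mul0r.
  by move/addrI.
have st : s = td d0 by apply: sum_translates.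
have {}Tcd (c : mor y z) (d : mor x y) : T (c \oc d) = s * phi b' (c \oc d).
  rewrite Tcd /phi BE mulrDr; congr (_ + _).
  have [/lorbitP [h ->]|dd] := boolP (d \in lorbit d0); last first.
    by rewrite td0 // andbF !mulr0.
  rewrite andbT mulrC st; congr (_ * _); apply: eq_bigl => g.
  by rewrite -compmA lorbit_comp.
exists s; split=> [m|]; first by have [c [d ->]] := bis_surj m; rewrite Tcd.
have [w w1] := orbit_weight k (rorbit_equivalence (x := y) (y := z)).
(* With weights that single out one c in each class c H, the functions c d0 D_b
   sum up to b n + 1, whereas c1 d1 D_b = b. *)
pose n := \sum_c w c.
have sum_wc (l : autg z) (q r : k) :
    \sum_c (r * w c) * (q + (l \oc c \in rorbit c0)%:R) = r * (n * q + 1).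
  under eq_bigr do rewrite -mulrA mulrDr.
  rewrite -mulr_sumr big_split /= -mulr_suml; congr (_ * (_ + _)).
  rewrite -[RHS](w1 ((l^-1)%g \oc c0)) [RHS]big_mkcond /=; apply: eq_bigr => c _.
  have -> : (c \in rorbit ((l^-1)%g \oc c0)) = (l \oc c \in rorbit c0).
    apply/rorbitP/rorbitP=> -[h e]; exists h; first by rewrite e -compmA autmV.
    by rewrite -compmA -e autVm.
  by case: ifP; rewrite ?mulr1 ?mulr0.
have {}rel :
    \sum_c (b * w c) *: T (c \oc d0) = (1 + b * n) *: T (c1 \oc d1).
  apply: rel => l.
  under eq_bigr do rewrite /phi compmA BE lorbit_id andbT.
  rewrite /phi compmA BE (negPf d1d0) andbF addr0.
  by rewrite [LHS]sum_wc [RHS]mulrDl mulrDr mul1r mulr1 addrC mulrA.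
have : \sum_c (s * b * w c) * (b' + (idm z \oc c \in rorbit c0)%:R)
       = (1 + b * n) * (s * b').
  move: rel; rewrite Tcd /phi BE (negPf c1c0) addr0 => rel.
  rewrite -[RHS]rel; apply: eq_bigr => c _.
  rewrite Tcd /phi BE lorbit_id andbT comp1m -[RHS]/(b * w c * (s * _)).
  by rewrite [RHS]mulrCA !mulrA.
rewrite sum_wc mulrDr mulr1 mulrDl mul1r addrC.
have -> : s * b * (n * b') = b * n * (s * b').
  by rewrite [RHS]mulrACA (mulrC b s).
by move/addIr.
Qed.

(** An equation beta u^-1 alpha = l beta v^-1 alpha g holds in the biset product
    only if some h in H satisfies beta u^-1 = l beta v^-1 h and
    alpha g = h alpha; then r = u^-1 h^-1 v. *)
Lemma serial_double_coset (x y z : C) (alpha : mor x y) (beta : mor y z)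
    (u v : autg y) :
  comp_is_biset_product x y z ->
  exists (h r : autg y),
    [/\ h \in lstab alpha, r \in rstab beta & v = (h * u * r)%g].
Proof.
move=> [_ bisP].
have [l [g]] := hom_biorbit (beta \oc (v^-1)%g \oc alpha)
                            (beta \oc (u^-1)%g \oc alpha).
rewrite !compmA -[RHS]compmA => /bisP [h [eu ev]].
exists h, (u^-1 * h^-1 * v)%g; split; last by rewrite !mulgA mulgK mulgV mul1g.
- by apply: lstab_mem; apply/rorbitP; exists g.
- apply: rstab_mem; apply/lorbitP; exists l.
  by rewrite !compmA eu mautV mVaut.
Qed.

(** * Two hom-sets with common target: the second category *)

Section Cospan.
Variables (x z y : C).
Hypotheses (xz : x != z) (no_xz : mor x z -> False) (no_zx : mor z x -> False).

Section CospanFunction.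
Variables (U : lmodType k) (phi : mor x y -> U) (psi : mor z y -> U).

Definition cospan_fun : catfun C U := extend phi + extend psi.

Lemma cospan_funE n : cospan_fun n = extend phi n + extend psi n.
Proof. by rewrite ffunE. Qed.

Lemma cospan_funl (d : mor x y) : cospan_fun (arr d) = phi d.
Proof. by rewrite cospan_funE extendE extend_src ?addr0. Qed.

Lemma cospan_funr (e : mor z y) : cospan_fun (arr e) = psi e.
Proof. by rewrite cospan_funE extendE extend_src ?add0r // eq_sym. Qed.

Lemma cospan_fun_src (u v : C) (m : mor u v) :
  u != x -> u != z -> cospan_fun (arr m) = 0.
Proof. by move=> ux uz; rewrite cospan_funE !extend_src ?addr0. Qed.

Lemma cospan_fun_tgt (u v : C) (m : mor u v) :
  v != y -> cospan_fun (arr m) = 0.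
Proof. by move=> vy; rewrite cospan_funE !extend_tgt ?addr0. Qed.

End CospanFunction.

(** The analogue of [hom_family_absurd] for functions on C(x,y) and C(z,y). A
    translate of D_b can be nonzero on C(x,y) only if the translating morphism
    is an endomorphism of x, because C(z,x) is empty; likewise for z. *)
Lemma cospan_family_absurd (U : lmodType k) (phi : k -> mor x y -> U)
    (psi : k -> mor z y -> U) (d : mor x y) :
  (forall b, phi b d != 0) ->
  (forall b b' (Tx : mor x y -> U) (Tz : mor z y -> U),
     (exists t : mor x x -> k, forall d, Tx d = \sum_g t g *: phi b' (d \oc g)) ->
     (exists t : mor z z -> k, forall e, Tz e = \sum_g t g *: psi b' (e \oc g)) ->
     (forall (I J : finType) (a : I -> mor x y) (r : I -> k)
             (c : J -> mor z y) (s : J -> k),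
        (forall h : autg y, \sum_i r i *: phi b (h \oc a i) =
                            \sum_j s j *: psi b (h \oc c j)) ->
        \sum_i r i *: Tx (a i) = \sum_j s j *: Tz (c j)) ->
     exists s : k, [/\ forall d, Tx d = s *: phi b' d,
       forall e, Tz e = s *: psi b' e & s * b = s * b']) ->
  False.
Proof.
move=> phi0 brick.
pose D b := cospan_fun (phi b) (psi b).
case: (@scalar_family_infinite_type k C U D) => //.
  move=> b; apply: contra_neq (phi0 b).
  by move/(congr1 (fun F : catfun C U => F (arr d))); rewrite cospan_funl ffunE.
move=> b b' T TD le.
have [|||s [Tx Tz sb]] := brick b b' (fun d => T (arr d)) (fun e => T (arr e)).
- have [|t Tt] := cyclic_pred_at (x := x) (y := y) TD.
    move=> w m a wx; have [ew|wz] := eqVneq w z; last by rewrite cospan_fun_src.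
    by subst w; case: (no_zx a).
  by exists t => m; rewrite Tt; apply: eq_bigr => g _; rewrite cospan_funl.
- have [|t Tt] := cyclic_pred_at (x := z) (y := y) TD.
    move=> w m a wz; have [ew|wx] := eqVneq w x; last by rewrite cospan_fun_src.
    by subst w; case: (no_xz a).
  by exists t => m; rewrite Tt; apply: eq_bigr => g _; rewrite cospan_funr.
- move=> I J a r c s rel; apply: ann_le_rel le _ => v m.
  have [ev|vy] := eqVneq v y.
    subst v; under eq_bigr do rewrite cospan_funl.
    by under [RHS]eq_bigr do rewrite cospan_funr.
  by rewrite !big1 // => i _; rewrite cospan_fun_tgt ?scaler0.
exists s; split=> // u v m; have [ev|vy] := eqVneq v y; last first.
  rewrite (cyclic_pred_tgt m TD) ?cospan_fun_tgt ?scaler0 // => u' m'.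
  by rewrite cospan_fun_tgt.
subst v; have [eu|ux] := eqVneq u x; first by subst u; rewrite cospan_funl Tx.
have [eu|uz] := eqVneq u z; first by subst u; rewrite cospan_funr Tz.
rewrite (ann_le_src m le) ?cospan_fun_src ?scaler0 // => v' m'.
by rewrite cospan_fun_src.
Qed.

(** D_b is the indicator of alpha G on C(x,y), and on C(z,y) it is 1 on
    K beta L and b elsewhere, where K is the stabilizer of alpha G. The
    translates of alpha D_b by H are, as functions on H, the indicators of the
    cosets of K, and e D_b, which is constant on these cosets, is a combination
    of them with coefficients values of D_b; the same combination for T forces
    the two multipliers on C(x,y) and C(z,y) to agree. *)
Lemma cospan_double_coset (alpha : mor x y) (beta : mor z y) (u : autg y) :
  exists (h : autg y) (l : autg z),
    h \oc alpha \in rorbit alpha /\ u \oc beta = h \oc beta \oc l.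
Proof.
pose K (h : autg y) := h \oc alpha \in rorbit alpha.
pose E (e : mor z y) := [exists h : autg y, K h && (e \in rorbit (h \oc beta))].
have El e (l : autg z) : E (e \oc l) = E e.
  by apply: eq_existsb => h; rewrite rorbit_comp.
have K1 (h h' : autg y) : K h -> K (h * h')%g = K h'.
  move=> /rorbitP [g eg]; apply/rorbitP/rorbitP => -[g' e].
    exists (g^-1 * g')%g; rewrite -[LHS](autVm h) [h \oc _]compmA e.
    by rewrite -{1}[alpha](mautV alpha g) -eg -!compmA autVm.
  by exists (g * g')%g; rewrite -compmA e compmA eg compmA.
have Eh e (h : autg y) : K h -> E (h \oc e) = E e.
  move=> Kh; apply/existsP/existsP => -[h' /andP [Kh' /rorbitP [g e']]].
    exists (h^-1 * h')%g; rewrite -(K1 h) // mulKVg Kh'; apply/rorbitP; exists g.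
    by rewrite -[LHS](autVm h) e' !compmA.
  exists (h * h')%g; rewrite K1 // Kh'; apply/rorbitP; exists g.
  by rewrite e' !compmA.
have E0 : E beta.
  by apply/existsP; exists (idm y); rewrite /K !comp1m !rorbit_id.
have [/existsP [h /andP [Kh /rorbitP [l ->]]]|Eu] := boolP (E (u \oc beta)).
  by exists h, l.
exfalso.
pose phi (b : k) (d : mor x y) : k^o := (d \in rorbit alpha)%:R.
pose psi (b : k) (e : mor z y) : k^o := if E e then 1 else b.
apply: (cospan_family_absurd (phi := phi) (psi := psi) (d := alpha)).
  by move=> b; rewrite /phi rorbit_id oner_eq0.
move=> b b' Tx Tz [t Txt] [t' Tzt] rel.
pose s := \sum_g t g; pose s' := \sum_g t' g.
have {}Txt d : Tx d = s *: phi b' d.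
  by rewrite Txt scaler_suml; apply: eq_bigr => g _; rewrite /phi rorbit_comp.
have {}Tzt e : Tz e = s' *: psi b' e.
  by rewrite Tzt scaler_suml; apply: eq_bigr => g _; rewrite /psi El.
have Req : equivalence_rel
    (fun h h' : autg y => h' \oc alpha \in rorbit (h \oc alpha)).
  by move=> h h' h''; apply: rorbit_equivalence.
have [w w1] := orbit_weight k Req.
have sum_w (h : autg y) e : \sum_(h' : autg y) w h' * psi b ((h'^-1)%g \oc e) *
     phi b (h \oc (h' \oc alpha)) = psi b (h \oc e).
  transitivity (\sum_(h' : autg y |
      h' \oc alpha \in rorbit ((h^-1)%g \oc alpha)) w h' * psi b (h \oc e)).
    rewrite [RHS]big_mkcond; apply: eq_bigr => h' _.
    have -> : (h' \oc alpha \in rorbit ((h^-1)%g \oc alpha)) = K (h * h')%g.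
      apply/rorbitP/rorbitP => -[g e']; exists g.
        by rewrite -compmA e' -compmA autmV.
      by rewrite -compmA -e' -compmA autVm.
    rewrite /phi compmA -/(K _); case: ifP => [Khh|_]; last by rewrite mulr0.
    by rewrite mulr1 /psi -(Eh _ _ Khh) -compmA autmV.
  by rewrite -mulr_suml w1 mul1r.
have {}rel e :
    \sum_(h : autg y) (w h * psi b ((h^-1)%g \oc e)) *: Tx (h \oc alpha) = Tz e.
  have := rel (autg y : finType) ('I_1 : finType) (fun h => h \oc alpha)
    (fun h => w h * psi b ((h^-1)%g \oc e)) (fun=> e) (fun=> 1).
  by rewrite big_ord1 scale1r; apply=> h; rewrite big_ord1 scale1r; apply: sum_w.
have Tbb e : s * psi b e = s' * psi b' e.
  transitivity (Tz e); last by rewrite Tzt.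
  rewrite -rel -[in LHS](comp1m e) -(sum_w (idm y)) mulr_sumr.
  apply: eq_bigr => h _; rewrite Txt comp1m.
  by rewrite -[RHS]/(_ * (s * _)) [RHS]mulrCA.
have ss' : s = s' by have := Tbb beta; rewrite /psi E0 !mulr1.
exists s; split=> //; first by rewrite ss'.
by have := Tbb (u \oc beta); rewrite /psi (negPf Eu) -ss'.
Qed.

(** D_b takes values in k^2: on C(x,y) it is (1, 1) on the H-orbit of d0 and
    (0, 1) elsewhere; on C(z,y) it is (b, 1) on the H-orbit of e0 and (b, 0)
    elsewhere. Hence differences of translates give (1, 0) and (0, 1), of
    which the values of D_b at e1 and d1 are multiples, by b and 1 respectively:
    these are the two relations between translates. *)
Lemma cospan_transitive : ltransitive x y \/ ltransitive z y.
Proof.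
have [|[d0 [d1 d1d0]]] := ltransitiveVorbits x y; first by left.
have [|[e0 [e1 e1e0]]] := ltransitiveVorbits z y; first by right.
exfalso.
pose phi (b : k) (d : mor x y) : k^o * k^o := ((d \in lorbit d0)%:R, 1).
pose psi (b : k) (e : mor z y) : k^o * k^o := (b, (e \in lorbit e0)%:R).
apply: (cospan_family_absurd (phi := phi) (psi := psi) (d := d0)).
  by move=> b; apply/eqP=> /(congr1 snd) /eqP; rewrite /= oner_eq0.
move=> b b' Tx Tz [t Txt] [t' Tzt] rel.
pose s := \sum_g t g; pose s' := \sum_g t' g.
pose td d := \sum_(g | d \oc g \in lorbit d0) t g.
pose te e := \sum_(g | e \oc g \in lorbit e0) t' g.
have sum_pair (I : finType) (F : I -> k^o * k^o) :
    \sum_i F i = (\sum_i (F i).1, \sum_i (F i).2).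
  by apply: injective_projections; rewrite /= (raddf_sum fst, raddf_sum snd).
have {}Txt d : Tx d = (td d, s).
  rewrite Txt sum_pair; congr (_, _); last by apply: eq_bigr => g _; apply: mulr1.
  rewrite /td [RHS]big_mkcond; apply: eq_bigr => g _ /=.
  by case: ifP => _; [apply: mulr1 | apply: mulr0].
have {}Tzt e : Tz e = (s' * b', te e).
  rewrite Tzt sum_pair; congr (_, _).
    by rewrite /s' mulr_suml; apply: eq_bigr.
  rewrite /te [RHS]big_mkcond; apply: eq_bigr => g _ /=.
  by case: ifP => _; [apply: mulr1 | apply: mulr0].
(* e D_b = b (d0 - d) D_b *)
have R1 d e : d \notin lorbit d0 -> e \notin lorbit e0 ->
    te e = 0 /\ b * td d0 - b * td d = s' * b'.
  move=> dd ee.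
  have e' : b *: Tx d0 - b *: Tx d = Tz e.
    have := rel (bool : finType) ('I_1 : finType) (fun i => if i then d0 else d)
      (fun i => if i then b else - b) (fun=> e) (fun=> 1).
    rewrite big_bool big_ord1 /= scale1r scaleNr; apply=> h.
    rewrite big_bool big_ord1 /= scale1r scaleNr /phi /psi !lorbit_comp lorbit_id.
    rewrite (negPf dd) (negPf ee).
    apply: injective_projections => /=; last exact: subrr.
    by rewrite [b *: 1]mulr1 [b *: 0]mulr0 subr0.
  move: e'; rewrite Tzt !Txt => e'; split; last by have := congr1 fst e'.
  by have := congr1 snd e'; rewrite /= subrr => <-.
(* d D_b = (e0 - e) D_b *)
have R2 d e : d \notin lorbit d0 -> e \notin lorbit e0 ->
    td d = 0 /\ s = te e0 - te e.
  move=> dd ee.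
  have e' : Tx d = Tz e0 - Tz e.
    have := rel ('I_1 : finType) (bool : finType) (fun=> d) (fun=> 1)
      (fun i => if i then e0 else e) (fun i => if i then 1 else - 1).
    rewrite big_bool big_ord1 /= !scale1r scaleN1r; apply=> h.
    rewrite big_bool big_ord1 /= !scale1r scaleN1r /phi /psi !lorbit_comp lorbit_id.
    rewrite (negPf dd) (negPf ee).
    apply: injective_projections => /=; last by rewrite subr0.
    by rewrite subrr.
  move: e'; rewrite !Tzt Txt => e'; split; last by have := congr1 snd e'.
  by have := congr1 fst e'; rewrite /= subrr.
have s_td : s = td d0.
  by apply: sum_translates => d dd; apply: (R2 d e1 dd e1e0).1.
have s_te : s' = te e0.
  by apply: sum_translates => e ee; apply: (R1 d1 e d1d0 ee).1.
have ss' : s' = s.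
  by rewrite s_te (R2 d1 e1 d1d0 e1e0).2 (R1 d1 e1 d1d0 e1e0).1 subr0.
exists s; split.
- move=> d; rewrite Txt; apply: injective_projections => /=; last first.
    by rewrite [_ *: _]mulr1.
  have [/lorbitP [h ->]|dd] := boolP (d \in lorbit d0); last first.
    by rewrite [_ *: _]mulr0 (R2 d e1 dd e1e0).1.
  rewrite [_ *: _]mulr1 s_td; apply: eq_bigl => g.
  by rewrite -compmA lorbit_comp.
- move=> e; rewrite Tzt ss'; apply: injective_projections => //=.
  have [/lorbitP [h ->]|ee] := boolP (e \in lorbit e0); last first.
    by rewrite [_ *: _]mulr0 (R1 d1 e d1d0 ee).1.
  rewrite [_ *: _]mulr1 -ss' s_te; apply: eq_bigl => g.
  by rewrite -compmA lorbit_comp.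
- have := (R1 d1 e1 d1d0 e1e0).2.
  by rewrite (R2 d1 e1 d1d0 e1e0).1 mulr0 subr0 -s_td ss' mulrC.
Qed.

End Cospan.

End FiniteType.

(** * Conclusion *)

Lemma card_double_cosets_eq1 (gT : finGroupType) (A B : {set gT}) :
  (forall u v : gT, exists a b, [/\ a \in A, b \in B & v = (a * u * b)%g]) ->
  #|double_cosets A B| = 1%N.
Proof.
move=> dc; suff -> : double_cosets A B = [set [set: gT]] by rewrite cards1.
have full u : (A * [set u] * B)%g = [set: gT].
  apply/setP=> v; rewrite inE; have [a [b [aA bB ->]]] := dc u v.
  by rewrite !mem_mulg ?set11.
apply/setP=> S; rewrite inE; apply/imsetP/eqP => [[u _ ->]|->]; first exact: full.
by exists 1%g; rewrite ?full.
Qed.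

Theorem proposition5p6 (k : closedFieldType)
  (char_neq2 : 2%N \notin [pchar k]) (char_neq3 : 3%N \notin [pchar k])
  (C : finEICat) (C_free : free_cat C)
  (x y z : C) (C_objects : objects_are x y z)
  (C_finite : finite_representation_type (catalg k C)) :
  (forall (alpha : mor x y) (beta : mor y z), first_type alpha beta ->
     (ltransitive x y \/ rtransitive y z) /\
     #|double_cosets (lstab alpha) (rstab beta)| = 1%N) /\
  (forall (alpha : mor x y) (beta : mor z y), second_type alpha beta ->
     (ltransitive x y \/ ltransitive z y) /\
     #|double_cosets (lstab alpha) (lstab beta)| = 1%N).
Proof.
split=> alpha beta.
  case=> _ _ bis _; split; first exact (serial_transitive C_finite bis).
  apply: card_double_cosets_eq1 => u v.
  exact (serial_double_coset C_finite alpha beta u v bis).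
case=> _ _ no_other; have [/and3P [xyz yz _] _] := C_objects.
move: xyz yz; rewrite !inE negb_or => /andP [xy xz] yz.
have no_xz : mor x z -> False.
  apply: no_other => //.
  by rewrite !inE !xpair_eqE eqxx eq_sym (negPf yz) (negPf xz).
have no_zx : mor z x -> False.
  apply: no_other; first by rewrite eq_sym.
  by rewrite !inE !xpair_eqE (negPf xy) !andbF.
split; first exact (cospan_transitive C_finite y xz no_xz no_zx).
apply: card_double_cosets_eq1 => u v.
(* Here v u^-1 (u beta) = h (u beta) l, so that r = u^-1 h^-1 v stabilizes
   beta L. *)
have [h [l [h_alpha e]]] :=
  cospan_double_coset C_finite xz no_xz no_zx alpha (u \oc beta) (v * u^-1)%g.
exists h, (u^-1 * h^-1 * v)%g; split; last by rewrite !mulgA mulgK mulgV mul1g.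
- exact: lstab_mem.
- apply: lstab_mem; apply/rorbitP; exists l.
  move: e; rewrite !compmA => e.
  have {}e : v \oc beta = h \oc u \oc beta \oc l.
    by rewrite -e -[_ \oc u]/(v * u^-1 * u)%g mulgKV.
  rewrite -[LHS]/((u^-1 * h^-1)%g \oc v \oc beta) -[LHS]compmA e -[LHS]compmA.
  by rewrite -!compmA !autVm.
Qed.
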